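(* Let $0<p\le q\le r$, and for $0<u\le v$ let $V_{u,v}$ denote a positive random variable with the unique factor law such that $X_u\stackrel{d}{=}V_{u,v}X_v$ (with $V_{u,v}$ independent of $X_v$). If $V_{p,q}$ and $V_{q,r}$ are chosen independent of each other and of $X_r$, then $$V_{p,r}\stackrel{d}{=}V_{p,q}V_{q,r}.$$
   Context: For $r>0$, $X_r\sim N_r(0,1)$ means that $X_r$ is a real random variable with density $$f_r(x)=\frac{r}{2^{1+1/r}\Gamma(1/r)}\exp\left(-\frac{|x|^r}{2}\right),\qquad x\in\mathbb{R}.$$ For $0<u\le v$, the factor law is the law of a strictly positive random variable $V_{u,v}$, independent of $X_v\sim N_v(0,1)$, such that $V_{u,v}X_v\stackrel{d}{=}X_u$ with $X_u\sim N_u(0,1)$; such a law exists and is unique whenever $u\le v$. The notation $\stackrel{d}{=}$ means equality in distribution. *)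

(* Defs.v *)
From HB Require Import structures.
From mathcomp Require Import all_boot all_order all_algebra.
From mathcomp Require Import all_classical all_reals all_analysis measurable_realfun.

Set Implicit Arguments.
Unset Strict Implicit.
Unset Printing Implicit Defensive.

Import Order.TTheory GRing.Theory Num.Theory.
Import numFieldNormedType.Exports.

Local Open Scope classical_set_scope.
Local Open Scope ring_scope.

(* Euler's Gamma function; only meaningful for 0 < a (the integral diverges
   otherwise, and [fine] sends +oo to 0). *)
Definition Gamma (R : realType) (a : R) : R :=
  \int[@lebesgue_measure R]_(t in `]0, +oo[) (t `^ (a - 1) * expR (- t)).

Definition gnormal_pdf (R : realType) (r x : R) : R :=
  r / (2 `^ (1 + r^-1) * Gamma (r^-1)) * expR (- (`|x| `^ r / 2)).

(* X ~ N_r(0,1) *)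
Definition gnormal_law (R : realType) (r : R) (d : measure_display)
    (T : measurableType d) (P : probability T R) (X : {RV P >-> R}) : Prop :=
  forall A : set R, measurable A ->
    distribution P X A =
    (\int[@lebesgue_measure R]_(x in A) (gnormal_pdf r x)%:E)%E.

(* Mutual independence of X_0, ..., X_{n-1}: independence of subfamilies is
   the case where some of the A i are setT. *)
Definition mutually_independent (R : realType) (d : measure_display)
    (T : measurableType d) (P : probability T R) (n : nat)
    (X : n.-tuple {RV P >-> R}) : Prop :=
  forall A : 'I_n -> set R, (forall i, measurable (A i)) ->
    P (\bigcap_(i in [set: 'I_n]) (tnth X i @^-1` A i)) =
    (\prod_(i < n) P (tnth X i @^-1` A i))%E.

(* Equality in distribution; the variables may live on different spaces. The
   comparison is restricted to Borel sets since [distribution P X] is a total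
   set function whose values elsewhere are unspecified. *)
Definition eq_dist (R : realType)
    (d : measure_display) (T : measurableType d) (P : probability T R)
    (X : {RV P >-> R})
    (d' : measure_display) (T' : measurableType d') (P' : probability T' R)
    (Y : {RV P' >-> R}) : Prop :=
  forall A : set R, measurable A -> distribution P X A = distribution P' Y A.

Definition positive_rv (R : realType) (d : measure_display)
    (T : measurableType d) (P : probability T R) (V : {RV P >-> R}) : Prop :=
  {ae P, forall w, 0 < V w}.

(* V has the same law as a positive V' living on a space that carries an
   independent X ~ N_v(0,1) with V' X ~ N_u(0,1); the space of V itself need not
   carry such an X. Neither existence nor uniqueness of this law (both hold for
   0 < u <= v) is built into the definition. *)
Definition factor_law (R : realType) (u v : R) (d : measure_display)
    (T : measurableType d) (P : probability T R) (V : {RV P >-> R}) : Prop :=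
  exists (d' : measure_display) (T' : measurableType d')
      (P' : probability T' R) (V' X : {RV P' >-> R}),
    [/\ positive_rv V', gnormal_law v X, mutually_independent [tuple V'; X],
        gnormal_law u (V' * X : {RV P' >-> R}) & eq_dist V V'].

(* Main.v *)
Require Import Defs.
From HB Require Import structures.
From mathcomp Require Import all_boot all_order all_algebra.
From mathcomp Require Import all_classical all_reals all_analysis measurable_realfun.
From mathcomp Require Import ring lra.

(* The law of a positive V is determined by that of V X when X ~ N_r(0,1) is
   independent of V.  Indeed, by the scaling x |-> (k+1)^(1/r) x of the density
   of X, the numbers P(0 < V X <= b) determine the expectations of
   exp(-k X^r/2) 1{X > 0, 0 < V X <= 1} for all k >= 0, hence those of
   (1 - exp(-n X^r/2))^m 1{X > 0, 0 < V X <= 1}.  For suitable m = m(n) the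
   first factor tends to 1{X > t}, so P(s < X <= t, 0 < V X <= 1) is determined.
   This probability lies between P(s < X <= t) P(0 < V <= 1/t) and
   P(s < X <= t) P(0 < V <= 1/s); letting s and t come together yields the
   distribution function of V.
   Now Vqr Xr ~ N_q is independent of Vpq, so Vpq (Vqr Xr) ~ N_p, and Vpq Vqr is
   positive and independent of Xr: it has the law of Vpr. *)

Set Implicit Arguments.
Unset Strict Implicit.
Unset Printing Implicit Defensive.

Import Order.TTheory GRing.Theory Num.Theory.
Import numFieldNormedType.Exports.

Local Open Scope classical_set_scope.
Local Open Scope ring_scope.

(** * Integration against a density, and scaling of Lebesgue measure *)

(* [lebesgue_measure] is a measure on [measurableTypeR R], whose display differs
   from that of [R]; the next lemma transfers the result to measures on [R]. *)
Lemma integral_density_measurableTypeR (R : realType)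
    (xi : probability (measurableTypeR R) R) (h f : R -> R) :
  measurable_fun setT h ->
  (forall A : set R, measurable A ->
    xi A = (\int[@lebesgue_measure R]_(x in A) (h x)%:E)%E) ->
  forall D : set R, measurable D -> xi.-integrable D (EFin \o f) ->
  (\int[xi]_(x in D) (f x)%:E =
   \int[@lebesgue_measure R]_(x in D) (f x * h x)%:E)%E.
Proof.
move=> mh xiE D mD fi.
have xidom : xi `<< (@lebesgue_measure R).
  apply/null_content_dominatesP => A mA A0.
  by rewrite xiE// null_set_integral//; exact/measurable_EFinP/measurable_funTS.
rewrite -(Radon_Nikodym_change_of_variables xidom mD fi).
apply: ae_eq_integral => //.
- apply: emeasurable_funM; first exact: measurable_int fi.
  apply: (measurable_int (@lebesgue_measure R)).
  apply: (integrableS _ _ (@subsetT _ _)) => //=.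
  exact: Radon_Nikodym_integrable.
- have /measurable_EFinP mf := measurable_int _ fi.
  by apply/measurable_EFinP/measurable_funM => //; exact: measurable_funTS.
- rewrite (_ : (fun x => (f x * h x)%:E) = (fun x => (f x)%:E * (h x)%:E)%E)//.
  apply: ae_eqe_mul2l => /=.
  (* The Radon-Nikodym derivative of [xi] and [h] have the same integral over each measurable subset
     of [D], so they agree almost everywhere there. *)
  apply: integral_ae_eq => //=.
  + by apply: (integrableS measurableT) => //; exact: Radon_Nikodym_integrable.
  + exact/measurable_EFinP/measurable_funTS.
  + by move=> E ED mE; rewrite -Radon_Nikodym_integral//= xiE.
Qed.

Lemma integral_density (R : realType) (xi : probability R R) (h f : R -> R) :
  measurable_fun setT h -> measurable_fun setT f ->
  (forall A : set R, measurable A ->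
    xi A = (\int[@lebesgue_measure R]_(x in A) (h x)%:E)%E) ->
  forall D : set R, measurable D -> xi.-integrable D (EFin \o f) ->
  (\int[xi]_(x in D) (f x)%:E =
   \int[@lebesgue_measure R]_(x in D) (f x * h x)%:E)%E.
Proof.
move=> mh mf xiE D mD fi.
(* The identity is measurable between the two structures on the reals, so [xi] is pushed forward
   along it and the integral pulled back. *)
have mid : measurable_fun setT (idfun : R -> measurableTypeR R).
  by move=> _ A mA; rewrite setTI; exact: mA.
pose i : {mfun R >-> measurableTypeR R} := HB.pack
  (idfun : R -> measurableTypeR R) (isMeasurableFun.Build _ _ _ _ _ mid).
rewrite -(@integral_density_measurableTypeR R (distribution xi i))//.
rewrite integral_pushforward//.
  exact/measurable_EFinP.
apply: integrable_pushforward => //.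
  exact/measurable_EFinP/measurable_funTS.
Qed.

(** Uniqueness of Lebesgue measure: [c] times the image measure under dilation by [c] gives each
    half-open interval its length. *)
Lemma lebesgue_measure_scale (R : realType) (c : R) (A : set R) : 0 < c ->
  measurable A ->
  pushforward (@lebesgue_measure R)
    ((fun x : R => c * x) : measurableTypeR R -> measurableTypeR R) A =
  ((c^-1)%:E * lebesgue_measure A)%E.
Proof.
move=> c0 mA.
have c1 : 0 <= c by exact: ltW.
have mc : measurable_fun setT
    ((fun x : R => c * x) : measurableTypeR R -> measurableTypeR R).
  exact: measurable_funM.
pose f : {mfun measurableTypeR R >-> measurableTypeR R} :=
  HB.pack (fun x : R => c * x) (isMeasurableFun.Build _ _ _ _ _ mc).
rewrite (@lebesgue_measure_unique R
  (mscale (NngNum c1) (pushforward (@lebesgue_measure R) f)))//=.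
  by rewrite /mscale /= muleA -EFinM mulVf ?mul1e// gt_eqF.
move=> _ [[a b] _ <-].
rewrite /mscale/= /pushforward/=.
rewrite (_ : f @^-1` _ = `]a / c, b / c]%classic); last first.
  apply/seteqP; split => x /=;
    by rewrite /f/= !in_itv/= ltr_pdivrMr// ler_pdivlMr// ![_ * c]mulrC.
rewrite !lebesgue_measure_itv /= !lte_fin ltr_pM2r ?invr_gt0//.
case: ifPn; rewrite ?mule0// => _.
by rewrite -!EFinD -EFinM -mulrBl mulrC divfK// gt_eqF.
Qed.

(** * Exponential weights and their behaviour under dilation *)

(** For [k = 1] this is the density of N_r(0,1) up to its constant. The parameter [k] makes the
    family closed under products, which add the values of [k]. *)
Definition gexp (R : realType) (r k x : R) : R :=
  expR (- (k * (`|x| `^ r / 2))).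

Lemma measurable_gexp (R : realType) (r k : R) : measurable_fun setT (gexp r k).
Proof.
apply: measurableT_comp => //; apply: measurableT_comp => //.
apply: measurable_funM => //; apply: measurable_funM => //.
apply: (measurableT_comp (measurable_powR _)) => //.
Qed.

Lemma gexp_ge0 (R : realType) (r k x : R) : 0 <= gexp r k x.
Proof. exact: expR_ge0. Qed.

Lemma gexp_gt0 (R : realType) (r k x : R) : 0 < gexp r k x.
Proof. exact: expR_gt0. Qed.

Lemma gexp_le1 (R : realType) (r k x : R) : 0 <= k -> gexp r k x <= 1.
Proof.
move=> k0; rewrite /gexp -[leRHS]expR0 ler_expR oppr_le0.
by rewrite mulr_ge0// divr_ge0// powR_ge0.
Qed.

Lemma gexpD (R : realType) (r k l x : R) :
  gexp r (k + l) x = gexp r k x * gexp r l x.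
Proof. by rewrite /gexp -expRD -opprD -mulrDl. Qed.

(** Since (k^(1/r))^r = k, changing the weight amounts to dilating the variable. *)
Lemma gexp_scale (R : realType) (r k x : R) : 0 < r -> 0 <= k ->
  gexp r 1 (k `^ r^-1 * x) = gexp r k x.
Proof.
move=> r0 k0; rewrite /gexp mul1r normrM powRM// (ger0_norm (powR_ge0 _ _)).
by rewrite -powRrM mulVf ?gt_eqF// powRr1// mulrA.
Qed.

Lemma integral_scale (R : realType) (c t : R) (F : R -> R) : 0 < c ->
  measurable_fun setT F -> (forall x, 0 <= F x) ->
  (\int[@lebesgue_measure R]_(x in `]0%R, t]) (F (c * x))%:E =
   (c^-1)%:E * \int[@lebesgue_measure R]_(x in `]0%R, (c * t)%R]) (F x)%:E)%E.
Proof.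
move=> c0 mF F0.
have ci0 : 0 <= c^-1 by rewrite invr_ge0 ltW.
pose phi : measurableTypeR R -> measurableTypeR R := fun x : R => c * x.
have mphi : measurable_fun setT phi by apply: measurable_funM.
transitivity (\int[mscale (NngNum ci0) (@lebesgue_measure R)]_(x in
  `]0%R, (c * t)%R]) (F x)%:E)%E; last first.
  rewrite ge0_integral_mscale//; last by move=> ? _; rewrite lee_fin.
  exact/measurable_EFinP/measurable_funTS.
transitivity (\int[pushforward (@lebesgue_measure R) phi]_(x in
  `]0%R, (c * t)%R]) (F x)%:E)%E.
  rewrite ge0_integral_pushforward//; last 2 first.
    exact/measurable_EFinP/measurable_funTS.
    by move=> ? _; rewrite lee_fin.
  rewrite (_ : phi @^-1` _ = `]0, t]%classic)//.
  by apply/seteqP; split => x /=; rewrite /phi !in_itv/= ler_pM2l// pmulr_rgt0.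
apply: eq_measure_integral => A mA _ /=.
by rewrite /mscale/= -lebesgue_measure_scale.
Qed.

Lemma integrable_unit_interval d (T : measurableType d) (R : realType)
    (P : probability T R) (D : set T) (f : T -> R) :
  measurable D -> measurable_fun setT f -> (forall x, 0 <= f x <= 1) ->
  P.-integrable D (EFin \o f).
Proof.
move=> mD mf f01; apply: measurable_bounded_integrable => //.
- by rewrite -ge0_fin_numE// fin_num_measure.
- exact: measurable_funTS.
- exists 1; split => // M M1 x _ /=.
  by have /andP[f0 f1] := f01 x; rewrite ger0_norm// (le_trans f1)// ltW.
Qed.

Section generalized_normal.
Context (R : realType) (xi : probability R R) (r c : R).
Hypotheses (r0 : 0 < r) (c0 : 0 <= c).
Hypothesis xiE : forall A : set R, measurable A ->
  xi A = (\int[@lebesgue_measure R]_(x in A) (c * gexp r 1 x)%:E)%E.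

Let mdens : measurable_fun setT (fun x => c * gexp r 1 x).
Proof. by apply: measurable_funM => //; exact: measurable_gexp. Qed.

(** Multiplying the density by the weight [k] gives the weight [k + 1], that is, the density at
    (k+1)^(1/r) x; a linear change of variable finishes. *)
Lemma integral_gexp k t : 0 <= k ->
  (\int[xi]_(x in `]0%R, t]) (gexp r k x)%:E =
   (((k + 1) `^ r^-1)^-1)%:E * xi `]0%R, ((k + 1) `^ r^-1 * t)%R]%classic)%E.
Proof.
move=> k0.
have k1 : 0 < k + 1 by rewrite ltr_wpDl.
rewrite (integral_density mdens)//; last 2 first.
  exact: measurable_gexp.
  apply: integrable_unit_interval => //; first exact: measurable_gexp.
  by move=> x; rewrite gexp_ge0 gexp_le1.
rewrite xiE// -(integral_scale _ (powR_gt0 _ k1) mdens); last first.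
  by move=> x; rewrite mulr_ge0// gexp_ge0.
apply: eq_integral => x _.
by rewrite gexp_scale// ?(ltW k1)// gexpD mulrCA.
Qed.

End generalized_normal.

(** * The event 0 < V X <= b as a planar region *)

(** The first coordinate stands for V, the second for X. Asking for both signs, not just that of the
    product, removes the quadrant where both are negative. *)
Definition hyperbolic_region (R : realType) (b : R) : set (R * R) :=
  [set z | [/\ 0 < z.1, 0 < z.2 & z.1 * z.2 <= b]].

Lemma measurable_hyperbolic_region (R : realType) (b : R) :
  measurable (hyperbolic_region b).
Proof.
rewrite (_ : hyperbolic_region b =
  fst @^-1` `]0, +oo[%classic `&` (snd @^-1` `]0, +oo[%classic `&`
  (fst \* snd) @^-1` `]-oo, b]%classic)); last first.
  apply/seteqP; split => -[x y] /=; rewrite !in_itv/= !andbT.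
    by case.
  by move=> [? [? ?]].
have m1 : measurable_fun setT (fst : R * R -> R) by exact: measurable_fst.
have m2 : measurable_fun setT (snd : R * R -> R) by exact: measurable_snd.
apply: measurableI; first by rewrite -[X in measurable X]setTI; exact: m1.
apply: measurableI; first by rewrite -[X in measurable X]setTI; exact: m2.
by rewrite -[X in measurable X]setTI; exact: measurable_funM.
Qed.

Lemma xsection_hyperbolic_region (R : realType) (b v : R) :
  xsection (hyperbolic_region b) v =
  if 0 < v then `]0, b / v]%classic else set0.
Proof.
apply/seteqP; split => x; rewrite /xsection/= inE /hyperbolic_region/=.
  by move=> [v0 x0 vx]; rewrite v0/= in_itv/= x0 ler_pdivlMr// mulrC.
case: ifPn => // v0; rewrite /= in_itv/= ler_pdivlMr// mulrC => /andP[x0 vx].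
by split.
Qed.

Section region_integral.
Context (R : realType) (xi : probability R R) (r c : R).
Hypotheses (r0 : 0 < r) (c0 : 0 <= c).
Hypothesis xiE : forall A : set R, measurable A ->
  xi A = (\int[@lebesgue_measure R]_(x in A) (c * gexp r 1 x)%:E)%E.

(** By Tonelli, integrate first over X: the section at v > 0 is the interval from 0 to b/v, and the
    dilation factor given by [integral_gexp] does not depend on v. *)
Lemma integral_region_gexp (mu : probability R R) k b : 0 <= k ->
  (\int[mu \x xi]_(z in hyperbolic_region b) (gexp r k z.2)%:E =
   (((k + 1) `^ r^-1)^-1)%:E *
   (mu \x xi) (hyperbolic_region ((k + 1) `^ r^-1 * b)))%E.
Proof.
move=> k0; set l := _ `^ _.
have l0 : 0 < l by rewrite powR_gt0// ltr_wpDl.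
have mD := measurable_hyperbolic_region b.
have mg : measurable_fun setT (fun z : R * R => (gexp r k z.2)%:E).
  apply/measurable_EFinP/measurableT_comp => //; exact: measurable_gexp.
rewrite integral_mkcond fubini_tonelli1/=; last 2 first.
  by apply/(measurable_restrictT _ mD); exact: measurable_funTS.
  by move=> z; rewrite patchE; case: ifPn => // _; rewrite lee_fin gexp_ge0.
rewrite /product_measure1 -ge0_integralZl//=; last 2 first.
  by apply: measurable_fun_xsection; exact: measurable_hyperbolic_region.
  by rewrite lee_fin invr_ge0 ltW.
apply: eq_integral => v _; rewrite /fubini_F/=.
transitivity
  (\int[xi]_(x in xsection (hyperbolic_region b) v) (gexp r k x)%:E)%E.
  rewrite [RHS]integral_mkcond; apply: eq_integral => x _.
  by rewrite !patchE mem_xsection.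
rewrite !xsection_hyperbolic_region; case: ifPn => v0.
  by rewrite (integral_gexp _ _ xiE)// mulrA.
by rewrite integral_set0 measure0 mule0.
Qed.

End region_integral.

(** * Elementary inequalities and a sequence converging to a threshold *)

Lemma bernoulli_inequality (R : realFieldType) (t : R) (m : nat) : t <= 1 ->
  1 - m%:R * t <= (1 - t) ^+ m.
Proof.
move=> t1; elim: m => [|m IH]; first by rewrite expr0 mul0r subr0.
rewrite exprS; apply: (@le_trans _ _ ((1 - t) * (1 - m%:R * t))).
  rewrite -natr1; have : 0 <= m%:R * t ^+ 2 by rewrite mulr_ge0// sqr_ge0.
  by lra.
by rewrite ler_wpM2l// subr_ge0.
Qed.

(** Bernoulli bounds 1 + m t by (1 + t)^m, and (1 - t)^m (1 + t)^m = (1 - t^2)^m <= 1. *)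
Lemma exprn_onem_le (R : realFieldType) (t : R) (m : nat) : 0 <= t <= 1 ->
  (1 - t) ^+ m <= (1 + m%:R * t)^-1.
Proof.
move=> /andP[t0 t1].
have mt : 0 < 1 + m%:R * t by rewrite ltr_pwDl// mulr_ge0.
rewrite -[leRHS]mul1r ler_pdivlMr//.
apply: (@le_trans _ _ ((1 - t) ^+ m * (1 + t) ^+ m)).
  rewrite ler_wpM2l// ?exprn_ge0 ?subr_ge0//.
  have := @bernoulli_inequality _ (- t) m.
  by rewrite mulrN !opprK; apply; lra.
by rewrite -exprMn exprn_ile1; nra.
Qed.

(** Each of the n terms of 1 + w + ... + w^(n-1) is at least w^n; the induction proves this
    comparison multiplied by 1 - w. *)
Lemma natr_mul_exprn_le (R : realFieldType) (w : R) (n : nat) : 0 <= w < 1 ->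
  n%:R * w ^+ n <= (1 - w)^-1.
Proof.
move=> /andP[w0 w1].
have w2 : 0 < 1 - w by lra.
rewrite -[leRHS]mul1r ler_pdivlMr//.
suff : n%:R * w ^+ n * (1 - w) <= 1 - w ^+ n.
  by have : 0 <= w ^+ n := exprn_ge0 _ w0; lra.
elim: n => [|n IH]; first by rewrite mul0r mul0r expr0 subrr.
rewrite exprS -natr1.
have h : 0 <= w ^+ n := exprn_ge0 _ w0.
have h1 : w ^+ n <= 1 by rewrite exprn_ile1// ltW.
have n0 : (0:R) <= n%:R by [].
have := ler_wpM2l w0 IH.
have : 0 <= w ^+ n * (1 - w) by rewrite mulr_ge0// ltW.
nra.
Qed.

Lemma cvg_natr_mul_exprn (R : realType) (z : R) : 0 <= z < 1 ->
  n%:R * z ^+ n @[n --> \oo] --> (0 : R).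
Proof.
move=> /andP[z0 z1].
(* With z = w^2, n z^n = (n w^n) w^n: the first factor is bounded and the second tends to 0. *)
set w := Num.sqrt z.
have w01 : 0 <= w < 1.
  by rewrite sqrtr_ge0/= -[ltRHS]sqrtr1 ltr_sqrt.
have /andP[w0 w1] := w01.
have zE : z = w * w by rewrite -expr2 sqr_sqrtr.
apply: (@squeeze_cvgr _ _ _ _ (fun=> 0) (geometric (1 - w)^-1 w)).
- apply: nearW => n /=; rewrite mulr_ge0 ?exprn_ge0//=.
  rewrite zE exprMn mulrA ler_wpM2r ?exprn_ge0//.
  exact: natr_mul_exprn_le.
- exact: cvg_cst.
- by apply: cvg_geometric; rewrite ger0_norm.
Qed.

(* The factor n in the exponent forces the limit 0, instead of exp(-1), at
   y = a. *)
Lemma cvg_threshold (R : realType) (a y : R) : 0 < a <= 1 -> 0 <= y <= 1 ->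
  (1 - y ^+ n) ^+ (Num.truncn (n%:R * a ^- n)).+1 @[n --> \oo] -->
  ((y < a)%R%:R : R).
Proof.
move=> /andP[a0 a1] /andP[y0 y1].
have yn01 n : 0 <= y ^+ n <= 1 by rewrite exprn_ge0// exprn_ile1.
have u0 n : 0 <= n%:R * a ^- n by rewrite mulr_ge0// invr_ge0 exprn_ge0// ltW.
case: ltP => [ya|ay].
(* With m the exponent, Bernoulli gives the lower bound 1 - m y^n, and m <= n a^-n + 1 yields m y^n
   <= n (y/a)^n + y^n, which tends to 0. *)
- apply: (@squeeze_cvgr _ _ _ _
    (fun n => 1 - (n%:R * (y / a) ^+ n + y ^+ n)) (fun=> 1)).
  + apply: nearW => n /=; have /andP[yn0 yn1] := yn01 n.
    apply/andP; split; last by rewrite exprn_ile1//; lra.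
    apply: le_trans (bernoulli_inequality _ yn1); rewrite lerD2l lerN2.
    rewrite -natr1 mulrDl mul1r lerD2r expr_div_n (mulrC (y ^+ n)) mulrA.
    rewrite ler_wpM2r//.
    by rewrite truncn_le.
  + rewrite -[X in _ --> X]subr0; apply: cvgB; first exact: cvg_cst.
    rewrite -[X in _ --> X]addr0; apply: cvgD.
      apply: cvg_natr_mul_exprn.
      by rewrite divr_ge0 ?(ltW a0)//= ltr_pdivrMr// mul1r.
    by apply: cvg_expr; rewrite ger0_norm// (lt_le_trans ya).
  + exact: cvg_cst.
(* Here m >= n a^-n, so m y^n >= n, and [exprn_onem_le] leaves at most 1/(n+1). *)
- apply: (@squeeze_cvgr _ _ _ _ (fun=> 0) (fun n => n.+1%:R^-1)).
  + apply: nearW => n /=; have /andP[yn0 yn1] := yn01 n.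
    rewrite exprn_ge0 ?subr_ge0//=.
    apply: (le_trans (exprn_onem_le _ (yn01 n))).
    have h : n%:R <= (Num.truncn (n%:R * a ^- n)).+1%:R * y ^+ n.
      apply: (@le_trans _ _ (n%:R * a ^- n * a ^+ n)).
        by rewrite divfK// expf_neq0// gt_eqF.
      apply: ler_pM; [by []|by rewrite exprn_ge0// ltW| |].
        by rewrite ltW// truncnS_gt.
      by rewrite lerXn2r// nnegrE// ltW.
    rewrite lef_pV2 ?posrE//; last by rewrite ltr_pwDl// mulr_ge0.
    by rewrite -nat1r lerD2l.
  + exact: cvg_cst.
  + exact: cvg_harmonic.
Qed.

(** * Comparing two factor laws through the hyperbolic regions *)

Lemma gexp_natmul (R : realType) (r x : R) (n : nat) :
  gexp r n%:R x = gexp r 1 x ^+ n.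
Proof. by rewrite /gexp mul1r -expRM_natl mulrN. Qed.

Section uniqueness.
Context (R : realType) (xi mu nu : probability R R) (r c : R).
Hypotheses (r0 : 0 < r) (c_gt0 : 0 < c).
Hypothesis xiE : forall A : set R, measurable A ->
  xi A = (\int[@lebesgue_measure R]_(x in A) (c * gexp r 1 x)%:E)%E.
Hypothesis munu : forall b, 0 < b ->
  (mu \x xi)%E (hyperbolic_region b) = (nu \x xi)%E (hyperbolic_region b).

Local Notation D := (@hyperbolic_region R 1).

Let c0 : 0 <= c. Proof. exact: ltW. Qed.

Let mD : measurable D. Proof. exact: measurable_hyperbolic_region. Qed.

Let h (k l : R) (m : nat) (x : R) := gexp r k x * (1 - gexp r l x) ^+ m.

Let mh k l m : measurable_fun setT (fun z : R * R => h k l m z.2).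
Proof.
have m0 j : measurable_fun setT (fun z : R * R => gexp r j z.2).
  by apply: (measurableT_comp (measurable_gexp r j)); exact: measurable_snd.
by apply: measurable_funM => //; apply: measurable_funX; exact: measurable_funB.
Qed.

Let h01 k l m x : 0 <= k -> 0 <= l -> 0 <= h k l m x <= 1.
Proof.
move=> k0 l0; rewrite /h mulr_ge0 ?gexp_ge0 ?exprn_ge0 ?subr_ge0 ?gexp_le1//=.
rewrite mulr_ile1 ?gexp_ge0 ?exprn_ge0 ?gexp_le1 ?subr_ge0 ?gexp_le1//.
by rewrite exprn_ile1// ?subr_ge0 ?gexp_le1// lerBlDr lerDl gexp_ge0.
Qed.

Let ih (m' : probability R R) k l m : 0 <= k -> 0 <= l ->
  (m' \x xi)%E.-integrable D (EFin \o (fun z => h k l m z.2)).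
Proof.
move=> k0 l0; apply: integrable_unit_interval; [exact: mD|exact: mh|].
by move=> z; exact: h01.
Qed.

(** Induction on [m]: splitting off one factor 1 - exp(-l x^r/2) gives a difference of two integrals
    of order [m], with weights [k] and [k + l]; hence [k] varies in the induction. The case [m = 0]
    is [integral_region_gexp] with [munu]. *)
Lemma eq_integral_gexp_onem k l m : 0 <= k -> 0 <= l ->
  \int[(mu \x xi)%E]_(z in D) (gexp r k z.2 * (1 - gexp r l z.2) ^+ m) =
  \int[(nu \x xi)%E]_(z in D) (gexp r k z.2 * (1 - gexp r l z.2) ^+ m).
Proof.
move=> k0 l0; elim: m k k0 => [|m IH] k k0.
  rewrite /Rintegral; congr fine.
  under eq_integral do rewrite expr0 mulr1.
  under [RHS]eq_integral do rewrite expr0 mulr1.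
  rewrite !(integral_region_gexp _ _ xiE)// munu//.
  by rewrite mulr1 powR_gt0// ltr_wpDl.
have E (m' : probability R R) :
    \int[(m' \x xi)%E]_(z in D)
      (gexp r k z.2 * (1 - gexp r l z.2) ^+ m.+1) =
    \int[(m' \x xi)%E]_(z in D) h k l m z.2 -
    \int[(m' \x xi)%E]_(z in D) h (k + l) l m z.2.
  rewrite -RintegralB ?ih ?addr_ge0//.
  apply: eq_Rintegral => z _; rewrite /h gexpD exprS.
  by rewrite mulrCA mulrBl mul1r mulrCA mulrA.
by rewrite !E /h !IH// addr_ge0.
Qed.

(** The integrands of [eq_integral_gexp_onem] with [k = 0], [l = n] and the exponent of
    [cvg_threshold] converge on [D] to the indicator of x > t. They are bounded by 1, so dominated
    convergence carries the equality to the limit. *)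
Lemma eq_region_snd_gt t : 0 < t ->
  (mu \x xi)%E (D `&` setT `*` `]t, +oo[%classic) =
  (nu \x xi)%E (D `&` setT `*` `]t, +oo[%classic).
Proof.
move=> t0.
pose a := gexp r 1 t.
have a01 : 0 < a <= 1 by rewrite gexp_gt0 gexp_le1.
pose m n := (Num.truncn (n%:R * a ^- n)).+1.
pose f n (z : R * R) := (h 0 n%:R (m n) z.2)%:E.
pose g (z : R * R) := ((gexp r 1 z.2 < a)%R%:R : R)%:E.
have mB : measurable (setT `*` `]t, +oo[%classic : set (R * R)).
  exact: measurableX.
have cv (m' : probability R R) :
   (\int[(m' \x xi)%E]_(z in D) f n z)%E @[n --> \oo] -->
   (m' \x xi)%E (D `&` setT `*` `]t, +oo[%classic).
  (* On [D] the second coordinate x is positive, and exp(-x^r/2) is strictly decreasing there, so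
     lying below the threshold [a] means x > t. *)
  have gE : {in D, g =1 EFin \o \1_(setT `*` `]t, +oo[%classic : set (R * R))}.
    move=> z; rewrite inE => -[z1 z2 _]; rewrite /g /= indicE.
    rewrite /a /gexp !mul1r ltr_expR ltrN2 ltr_pM2r ?invr_gt0//.
    rewrite !gtr0_norm//.
    have -> : (t `^ r < z.2 `^ r) = (t < z.2).
      apply/idP/idP; last by apply: gt0_ltr_powR; rewrite // nnegrE ltW.
      apply: contraTT; rewrite -!leNgt => zt.
      by apply: (ge0_ler_powR (ltW r0)) => //; rewrite nnegrE ltW.
    congr (_%:R%:E); congr nat_of_bool.
    apply/idP/idP => [tz|]; last by rewrite inE /= in_itv/= andbT => -[].
    by rewrite inE/= in_itv/= andbT.
  rewrite setIC -integral_indic// -(eq_integral _ _ gE)//.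
  have [] := @dominated_convergence _ _ _ (m' \x xi)%E D mD f g (fun=> 1%E).
  - by move=> n; apply/measurable_EFinP/measurable_funTS; exact: mh.
  - apply: (eq_measurable_fun _ (fun z zD => esym (gE z zD))).
    exact/measurable_EFinP/measurable_funTS.
  - apply: aeW => z _; rewrite /f /g; apply: cvg_EFin; first exact: nearW.
    rewrite (_ : _ \o _ = fun n =>
      (1 - gexp r 1 z.2 ^+ n) ^+ (Num.truncn (n%:R * a ^- n)).+1).
      by apply: cvg_threshold => //; rewrite gexp_ge0 gexp_le1.
    apply/funext => n /=; rewrite /h gexp_natmul.
    by rewrite {1}/gexp mul0r oppr0 expR0 mul1r.
  - rewrite (_ : (fun=> 1%E) = EFin \o cst 1)//.
    by apply: integrable_unit_interval => // z; rewrite ler01 lexx.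
  - apply: aeW => z n _; rewrite /f /= lee_fin.
    by have /andP[? ?] := h01 (m n) z.2 (lexx 0) (ler0n R n); rewrite ger0_norm.
  by [].
have := cv nu.
rewrite (_ : (fun n => _) = fun n => \int[(mu \x xi)%E]_(z in D) f n z)%E.
  by move=> /(cvg_unique _ (cv mu)); apply.
apply/funext => n; rewrite -[LHS]fineK ?integrable_fin_num ?ih//.
rewrite -[RHS]fineK ?integrable_fin_num ?ih//; congr EFin.
exact/esym/eq_integral_gexp_onem.
Qed.

Lemma eq_region_snd_itv s t : 0 < s -> s <= t ->
  (mu \x xi)%E (D `&` setT `*` `]s, t]%classic) =
  (nu \x xi)%E (D `&` setT `*` `]s, t]%classic).
Proof.
move=> s0 st.
have mB u : measurable (setT `*` `]u, +oo[%classic : set (R * R)).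
  exact: measurableX.
have E (m' : probability R R) :
    (m' \x xi)%E (D `&` setT `*` `]s, t]%classic) =
    ((m' \x xi) (D `&` setT `*` `]s, +oo[%classic) -
     (m' \x xi) (D `&` setT `*` `]t, +oo[%classic))%E.
  have tE : D `&` setT `*` `]t, +oo[%classic =
      (D `&` setT `*` `]s, +oo[%classic) `&` (D `&` setT `*` `]t, +oo[%classic).
    apply/seteqP; split => z; last by case.
    move=> [Dz [_ /=]]; rewrite in_itv/= andbT => tz.
    by split; split => //; split => //=;
      rewrite in_itv/= andbT// (le_lt_trans st).
  rewrite [X in (_ - _ X)%E]tE -measureD//; last 3 first.
  - exact: measurableI.
  - exact: measurableI.
  - rewrite (le_lt_trans (@probability_le1 _ _ _ (m' \x xi)%E _ _)) ?ltry//.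
    exact: measurableI.
  congr (m' \x xi)%E; apply/seteqP; split => -[v x].
    move=> [Dz [_ /=]]; rewrite in_itv/= => /andP[sx xt].
    split; first by split => //; split => //=; rewrite in_itv/= sx.
    by move=> [_ [_ /=]]; rewrite in_itv/= andbT ltNge xt.
  move=> [[Dz [_ /=]]]; rewrite in_itv/= andbT => sx n.
  split => //; split => //=; rewrite in_itv/= sx/= leNgt; apply/negP => tx.
  by apply: n; split => //; split => //=; rewrite in_itv/= tx.
by rewrite !E !eq_region_snd_gt// (lt_le_trans s0).
Qed.

(** The density decreases on the positive axis, so the mass is at least (t - s) times the density at
    t. Positivity allows the cancellation in [le_measure_itv]. *)
Let xi_itv_gt0 s t : 0 < s -> s < t -> (0 < xi `]s, t]%classic)%E.
Proof.
move=> s0 st; rewrite xiE//.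
apply: (@lt_le_trans _ _
  (\int[@lebesgue_measure R]_(x in `]s, t]) (c * gexp r 1 t)%:E)%E).
  rewrite integral_cst//= lebesgue_measure_itv/= lte_fin st.
  rewrite -EFinD -EFinM lte_fin.
  by rewrite mulr_gt0 ?subr_gt0// mulr_gt0// gexp_gt0.
apply: ge0_le_integral => //.
- by move=> x _; rewrite lee_fin mulr_ge0// gexp_ge0.
- apply/measurable_EFinP/measurable_funTS; apply: measurable_funM => //.
  exact: measurable_gexp.
- move=> x /=; rewrite in_itv/= => /andP[sx xt].
  rewrite lee_fin ler_wpM2l// /gexp ler_expR lerN2 !mul1r ler_pM2r ?invr_gt0//.
  have x0 : 0 < x by exact: lt_trans sx.
  rewrite !gtr0_norm//; last exact: lt_le_trans xt.
  apply: (ge0_ler_powR (ltW r0)) => //; rewrite nnegrE ltW//.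
  exact: lt_le_trans xt.
Qed.

(** Let x range over I, from 1/s' to 1/s. Then v <= s forces v x <= 1, and v x <= 1 forces v <= s'.
    So the part of [D] over I lies between two rectangles with side I, and the factor [xi I]
    cancels. *)
Lemma le_measure_itv s s' : 0 < s -> s < s' ->
  (mu `]0%R, s]%classic <= nu `]0%R, s']%classic)%E.
Proof.
move=> s0 ss'; have s'0 : 0 < s' by exact: lt_trans ss'.
have iss : s'^-1 < s^-1 by rewrite ltf_pV2.
have is0 : 0 < s'^-1 by rewrite invr_gt0.
pose I := `]s'^-1, s^-1]%classic.
have mI : measurable I by exact: measurable_itv.
have xI0 : (0 < xi I)%E by exact: xi_itv_gt0.
have mR (u : R) : measurable (`]0, u]%classic `*` I : set (R * R)).
  exact: measurableX.
have mDI : measurable (D `&` setT `*` I : set (R * R)).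
  by apply: measurableI => //; exact: measurableX.
have : (mu `]0%R, s]%classic * xi I <= nu `]0%R, s']%classic * xi I)%E.
  rewrite -!product_measure1E//.
  apply: (@le_trans _ _ ((mu \x xi)%E (D `&` setT `*` I))).
    apply: le_measure; rewrite ?inE//.
    move=> [v x] [/=]; rewrite /I/= !in_itv/= => /andP[v0 vs] /andP[sx xs].
    have x0 : 0 < x by exact: lt_trans sx.
    split; last by split => //; rewrite /I/= sx.
    split => //=.
    by rewrite -(mulfV (lt0r_neq0 s0)) ler_pM// ltW.
  rewrite (eq_region_snd_itv is0 (ltW iss)).
  apply: le_measure; rewrite ?inE//.
  move=> [v x] [[/= v0 x0 vx] [_ /=]]; rewrite /I/= in_itv/= => /andP[sx xs].
  split; rewrite /I/= ?in_itv/= ?sx ?v0//=.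
  rewrite leNgt; apply/negP => s'v.
  move: vx; rewrite leNgt => /negP; apply.
  by rewrite -(mulfV (lt0r_neq0 s'0)) ltr_pM// ltW.
by rewrite lee_pmul2r// fin_num_measure.
Qed.

End uniqueness.

(** * From intervals to all Borel sets *)

(** Continuity from above along the right ends s + 1/(n+1). It removes the gap between [s] and [s']
    in [le_measure_itv]. *)
Lemma le_measure_itv_right (R : realType) (m : probability R R) (s : R)
    (a : \bar R) :
  (forall t, s < t -> (a <= m `]0%R, t]%classic)%E) ->
  (a <= m `]0%R, s]%classic)%E.
Proof.
move=> am.
pose F n := `]0, s + n.+1%:R^-1]%classic.
have mF n : measurable (F n) by exact: measurable_itv.
have FE : \bigcap_n F n = `]0, s]%classic.
  apply/seteqP; split => x.
    move=> Fx; have := Fx 0%N I; rewrite /F/= !in_itv/= => /andP[-> _]/=.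
    apply/ler_addgt0Pr => e e0.
    have [n _ /(_ n (leqnn n))] := near_infty_natSinv_lt (PosNum e0).
    move=> /= ne; have := Fx n I; rewrite /F/= in_itv/= => /andP[_ xn].
    by rewrite (le_trans xn)// lerD2l ltW.
  rewrite /= in_itv/= => /andP[x0 xs] n _; rewrite /F/= in_itv/= x0/=.
  by rewrite (le_trans xs)// lerDl.
have cF : m (F n) @[n --> \oo] --> m `]0, s]%classic.
  rewrite -FE; apply: nonincreasing_cvg_mu => //.
  - by rewrite -ge0_fin_numE// fin_num_measure.
  - exact: bigcap_measurable.
  - move=> i j ij; apply/subsetPset => x.
    rewrite /F /= !in_itv/= => /andP[-> xj]/=.
    by rewrite (le_trans xj)// lerD2l lef_pV2 ?posrE// ler_nat.
rewrite -(cvg_lim _ cF)//; apply: lime_ge.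
  by apply/cvg_ex; eexists; exact: cF.
by apply: nearW => n; apply: am; rewrite ltrDl.
Qed.

(** The open right rays form a generating class stable under intersection. A ray from x <= 0 has
    mass 1; one from x > 0 is the positive axis minus an interval from 0 to x. *)
Lemma eq_measure_itv_pos (R : realType) (mu nu : probability R R) :
  mu `]0%R, +oo[%classic = 1%E -> nu `]0%R, +oo[%classic = 1%E ->
  (forall s, 0 < s -> mu `]0%R, s]%classic = nu `]0%R, s]%classic) ->
  forall A : set R, measurable A -> mu A = nu A.
Proof.
move=> mu1 nu1 munu.
have ray x : mu `]x, +oo[%classic = nu `]x, +oo[%classic.
  have [x0|x0] := leP x 0.
    have E (m : probability R R) : m `]0%R, +oo[%classic = 1%E ->
        m `]x, +oo[%classic = 1%E.
      move=> m1; apply/eqP; rewrite eq_le probability_le1//= -m1.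
      apply: le_measure; rewrite ?inE//.
      by apply: subset_itvr; rewrite bnd_simp.
    by rewrite !E.
  have E (m : probability R R) :
      m `]x, +oo[%classic = (m `]0%R, +oo[%classic - m `]0%R, x]%classic)%E.
    rewrite (_ : `]0, x]%classic = `]0, +oo[%classic `&` `]0, x]%classic).
      rewrite -measureD//; last by rewrite -ge0_fin_numE// fin_num_measure.
      congr (m _); apply/seteqP; split => y /=; rewrite !in_itv/= !andbT.
        by move=> xy; rewrite (lt_trans x0)//= leNgt xy.
      by move=> [-> /= /negP]; rewrite -ltNge.
    by apply/seteqP; split => y /=; rewrite !in_itv/= ?andbT;
      [move=> /andP[-> ->]|case].
  by rewrite !E mu1 nu1 munu.
move=> A mA.
apply: (@measure_unique _ R R (@RGenOInfty.G R)
  (fun n => `](- n%:R), +oo[%classic) _ _ _ _ mu nu) => //.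
- exact: (RGenOInfty.measurableE R).
- move=> _ _ [x ->] [y ->]; exists (Num.max x y).
  by apply/seteqP; split => z /=; rewrite !in_itv/= !andbT gt_max;
    [case=> -> ->|move=> /andP].
- by move=> n; exists (- n%:R).
- rewrite -subTset => x _; exists (Num.truncn `|x|).+1 => //=.
  rewrite in_itv/= andbT ltrNl (le_lt_trans _ (truncnS_gt _))//.
  by rewrite -normrN ler_norm.
- by move=> _ [x ->]; exact: ray.
- by move=> n; rewrite -ge0_fin_numE// fin_num_measure.
Qed.

(** * Independence, joint laws and products *)

Definition independent_rv (R : realType) (d : measure_display)
    (T : measurableType d) (P : probability T R) (X Y : {RV P >-> R}) : Prop :=
  forall A B : set R, measurable A -> measurable B ->
    P (X @^-1` A `&` Y @^-1` B) = (P (X @^-1` A) * P (Y @^-1` B))%E.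

Lemma mutually_independent2 (R : realType) (d : measure_display)
    (T : measurableType d) (P : probability T R) (X Y : {RV P >-> R}) :
  mutually_independent [tuple X; Y] -> independent_rv X Y.
Proof.
move=> XY A B mA mB.
have := XY (fun i : 'I_2 => if i == ord0 then A else B).
rewrite !big_ord_recl big_ord0 mule1 /= => <-; last by move=> i; case: ifP.
congr (P _); apply/seteqP; split => w.
  by move=> [XA YB] [[|[|//]] i] _; rewrite (tnth_nth X).
move=> XYw; have := XYw ord0 I; have := XYw (lift ord0 ord0) I.
  by rewrite !(tnth_nth X).
Qed.

Lemma mutually_independent3 (R : realType) (d : measure_display)
    (T : measurableType d) (P : probability T R) (X Y Z : {RV P >-> R}) :
  mutually_independent [tuple X; Y; Z] ->
  forall A B C : set R, measurable A -> measurable B -> measurable C ->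
    P (X @^-1` A `&` (Y @^-1` B `&` Z @^-1` C)) =
    (P (X @^-1` A) * (P (Y @^-1` B) * P (Z @^-1` C)))%E.
Proof.
move=> XYZ A B C mA mB mC.
(* The list has length 2, so index 2 falls on the default value [C] of [nth]. *)
have := XYZ (fun i : 'I_3 => nth C [:: A; B] i).
rewrite !big_ord_recl big_ord0 mule1 /= => <-; last first.
  by move=> [[|[|[|//]]] i].
congr (P _); apply/seteqP; split => w.
  by move=> [XA [YB ZC]] [[|[|[|//]]] i] _; rewrite (tnth_nth X).
move=> h; have := h ord0 I; have := h (lift ord0 ord0) I.
by have := h (lift ord0 (lift ord0 ord0)) I; rewrite !(tnth_nth X).
Qed.

Lemma measurable_pair_RV (R : realType) (d : measure_display)
    (T : measurableType d) (P : probability T R) (X Y : {RV P >-> R}) :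
  measurable_fun setT (fun w => (X w, Y w)).
Proof. exact: measurable_fun_pair. Qed.

Definition pair_RV (R : realType) (d : measure_display)
    (T : measurableType d) (P : probability T R) (X Y : {RV P >-> R}) :
    {RV P >-> (R * R)%type} :=
  HB.pack (fun w => (X w, Y w))
    (isMeasurableFun.Build _ _ _ _ _ (measurable_pair_RV X Y)).

(** The product measure is determined by its values on rectangles, which independence supplies. Free
    [mu] and [nu] let a marginal be replaced by the law of a variable on another space. *)
Lemma joint_law (R : realType) (d : measure_display)
    (T : measurableType d) (P : probability T R) (X Y : {RV P >-> R})
    (mu nu : probability R R) :
  independent_rv X Y ->
  (forall A, measurable A -> distribution P X A = mu A) ->
  (forall A, measurable A -> distribution P Y A = nu A) ->
  forall D, measurable D -> (mu \x nu)%E D = P [set w | D (X w, Y w)].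
Proof.
move=> XY Xmu Ynu D mD.
rewrite (@product_measure_unique _ _ _ _ _ _ _
  (distribution P (pair_RV X Y)))//.
move=> A B mA mB.
transitivity (distribution P X A * distribution P Y B)%E; first exact: XY.
by rewrite Xmu// Ynu.
Qed.

(** As functions of [D], both sides are finite measures agreeing on rectangles, a generating class
    stable under intersection. *)
Lemma independent_pair (R : realType) (d : measure_display)
    (T : measurableType d) (P : probability T R) (X Y Z : {RV P >-> R}) :
  (forall A B C : set R, measurable A -> measurable B -> measurable C ->
    P (X @^-1` A `&` (Y @^-1` B `&` Z @^-1` C)) =
    (P (X @^-1` A) * (P (Y @^-1` B) * P (Z @^-1` C)))%E) ->
  forall A D, measurable A -> measurable D ->
    P (X @^-1` A `&` [set w | D (Y w, Z w)]) =
    (P (X @^-1` A) * P [set w | D (Y w, Z w)])%E.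
Proof.
move=> XYZ A D mA mD.
have mXA : measurable (X @^-1` A) by exact: measurable_funPTI.
have YZ B C : measurable B -> measurable C ->
    P (Y @^-1` B `&` Z @^-1` C) = (P (Y @^-1` B) * P (Z @^-1` C))%E.
  move=> mB mC; have := XYZ _ _ _ measurableT mB mC.
  by rewrite preimage_setT setTI probability_setT mul1e.
have PA0 : 0 <= fine (P (X @^-1` A)) by rewrite fine_ge0.
have mYZ := measurable_pair_RV Y Z.
(* [m1] is the image under (Y, Z) of [P] restricted to X in [A]; [m2] is the law of (Y, Z) scaled by
   the probability of X in [A]. *)
pose m1_ := pushforward (mrestr P mXA) (pair_RV Y Z) :
  {measure set (R * R) -> \bar R}.
pose m1 := m1_ mYZ.
pose m2 : {measure set (R * R) -> \bar R} :=
  mscale (NngNum PA0) (distribution P (pair_RV Y Z)).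
have m2E B : m2 B = (P (X @^-1` A) * P [set w | B (Y w, Z w)])%E.
  by rewrite /m2/= /mscale/= fineK// fin_num_measure.
have m1E B : m1 B = P (X @^-1` A `&` [set w | B (Y w, Z w)]).
  by rewrite /m1/= /pushforward/= /mrestr setIC.
rewrite -m1E -m2E.
apply: (@measure_unique _ R (R * R)%type
  [set A `*` B | A in measurable & B in measurable] (fun=> setT)) => //.
- by rewrite measurable_prod_measurableType.
- move=> _ _ [A1 mA1 [B1 mB1 <-]] [A2 mA2 [B2 mB2 <-]]; rewrite -setXI.
  exists (A1 `&` A2); first exact: measurableI.
  by exists (B1 `&` B2) => //; exact: measurableI.
- by move=> _; exists setT => //; exists setT => //; rewrite setXTT.
- by rewrite bigcup_const.
- move=> _ [B mB [C mC <-]]; rewrite m1E m2E.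
  by rewrite (XYZ A B C)// -(YZ B C).
- move=> _; rewrite m1E (le_lt_trans (probability_le1 _ _)) ?ltry//.
  by apply: measurableI => //; exact: (@measurableT _ T).
Qed.

Lemma independent_mulr (R : realType) (d : measure_display)
    (T : measurableType d) (P : probability T R) (X Y Z : {RV P >-> R}) :
  (forall A B C : set R, measurable A -> measurable B -> measurable C ->
    P (X @^-1` A `&` (Y @^-1` B `&` Z @^-1` C)) =
    (P (X @^-1` A) * (P (Y @^-1` B) * P (Z @^-1` C)))%E) ->
  independent_rv X (Y * Z : {RV P >-> R}).
Proof.
move=> XYZ A B mA mB.
apply: (independent_pair XYZ (D := (fst \* snd) @^-1` B)) => //.
by rewrite -[X in measurable X]setTI; exact: measurable_funM.
Qed.

Lemma eq_dist_mul (R : realType)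
    (d : measure_display) (T : measurableType d) (P : probability T R)
    (X Y : {RV P >-> R})
    (d' : measure_display) (T' : measurableType d') (P' : probability T' R)
    (X' Y' : {RV P' >-> R}) :
  independent_rv X Y -> independent_rv X' Y' -> eq_dist X X' -> eq_dist Y Y' ->
  eq_dist (X * Y : {RV P >-> R}) (X' * Y' : {RV P' >-> R}).
Proof.
move=> XY XY' XX' YY' A mA.
have mD : measurable ((fst \* snd) @^-1` A : set (R * R)).
  by rewrite -[X in measurable X]setTI; exact: measurable_funM.
have := joint_law XY XX' YY' mD.
by rewrite (joint_law XY' (fun _ _ => erefl) (fun _ _ => erefl) mD).
Qed.

(** * Positive factors and the uniqueness of their law *)

Lemma probability_positive_rvN (R : realType) (d : measure_display)
    (T : measurableType d) (P : probability T R) (V : {RV P >-> R}) :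
  positive_rv V -> P (V @^-1` `]-oo, 0%R]%classic) = 0%E.
Proof.
move=> V0; apply: measure_negligible; first exact: measurable_funPTI.
case: V0 => N [mN PN VN]; exists N; split => // w; rewrite /= in_itv/= => Vw.
by apply: VN => /=; apply/negP; rewrite -leNgt.
Qed.

Lemma positive_rv_gt0 (R : realType) (d : measure_display)
    (T : measurableType d) (P : probability T R) (V : {RV P >-> R}) :
  positive_rv V -> distribution P V `]0%R, +oo[%classic = 1%E.
Proof.
move=> V0; rewrite -[`]0, +oo[%classic]setCK setCitvr probability_setC//.
by rewrite [X in (_ - X)%E]probability_positive_rvN// sube0.
Qed.

(** Where V > 0, the product V X is positive exactly when X is; the two events differ only on the
    null set V <= 0. *)
Lemma probability_region_mul (R : realType) (d : measure_display)
    (T : measurableType d) (P : probability T R) (V X : {RV P >-> R}) (b : R) :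
  positive_rv V ->
  P [set w | hyperbolic_region b (V w, X w)] =
  distribution P (V * X : {RV P >-> R}) `]0%R, b]%classic.
Proof.
move=> V0; rewrite [RHS]/distribution/= /pushforward.
have mVX : measurable ((V * X : {RV P >-> R}) @^-1` `]0, b]%classic).
  exact: measurable_funPTI.
have mV : measurable (V @^-1` `]-oo, 0%R]%classic).
  exact: measurable_funPTI.
rewrite (measureDI P mVX mV) [X in (_ + X)%E](_ : _ = 0%E) ?adde0; last first.
  apply/eqP; rewrite eq_le measure_ge0 andbT -(probability_positive_rvN V0).
  by apply: le_measure; rewrite ?inE//; exact: measurableI.
congr (P _); apply/seteqP; split => w; rewrite /hyperbolic_region/= !in_itv/=.
  move=> [Vw Xw VX]; split; last by apply/negP; rewrite -ltNge.
  by rewrite mulr_gt0.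
move=> [/andP[VX0 VXb] /negP]; rewrite -ltNge => Vw.
by split => //; rewrite -(pmulr_rgt0 _ Vw).
Qed.

(** The constant is nonnegative by its formula, and it cannot vanish because the total mass is 1;
    Gamma need not be evaluated. *)
Lemma gnormal_law_density (R : realType) (r : R) (d : measure_display)
    (T : measurableType d) (P : probability T R) (X : {RV P >-> R}) : 0 < r ->
  gnormal_law r X -> exists2 c : R, 0 < c &
  forall A : set R, measurable A -> distribution P X A =
    (\int[@lebesgue_measure R]_(x in A) (c * gexp r 1 x)%:E)%E.
Proof.
move=> r0 Xr; pose c := r / (2 `^ (1 + r^-1) * Gamma r^-1).
have cE A : measurable A -> distribution P X A =
    (\int[@lebesgue_measure R]_(x in A) (c * gexp r 1 x)%:E)%E.
  by move=> mA; rewrite Xr//; under [RHS]eq_integral do rewrite /gexp mul1r.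
exists c => //; rewrite lt_neqAle; apply/andP; split; last first.
  rewrite divr_ge0 ?(ltW r0)// mulr_ge0 ?powR_ge0// /Gamma.
  by apply: Rintegral_ge0 => x _; rewrite mulr_ge0 ?powR_ge0 ?expR_ge0.
apply/eqP => c0; have := cE setT measurableT.
rewrite -c0 probability_setT; under eq_integral do rewrite mul0r.
by rewrite integral0 => /eqP; rewrite onee_eq0.
Qed.

Lemma gnormal_factor_unique (R : realType) (r : R)
    (d : measure_display) (T : measurableType d) (P : probability T R)
    (V X : {RV P >-> R})
    (d' : measure_display) (T' : measurableType d') (P' : probability T' R)
    (V' X' : {RV P' >-> R}) :
  0 < r -> positive_rv V -> positive_rv V' ->
  independent_rv V X -> independent_rv V' X' ->
  gnormal_law r X -> gnormal_law r X' ->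
  eq_dist (V * X : {RV P >-> R}) (V' * X' : {RV P' >-> R}) -> eq_dist V V'.
Proof.
move=> r0 V0 V'0 VX VX' Xr X'r VXVX'.
have [c c0 cE] := gnormal_law_density r0 Xr.
(* X and X' have the same law, so both joint laws become products with the same second factor, as
   the uniqueness section requires. *)
have XX' : eq_dist X' X by move=> A mA; rewrite Xr// X'r.
have munu b : 0 < b ->
    (distribution P V \x distribution P X)%E (hyperbolic_region b) =
    (distribution P' V' \x distribution P X)%E (hyperbolic_region b).
  move=> b0; have mD := measurable_hyperbolic_region b.
  rewrite (joint_law VX (fun _ _ => erefl) (fun _ _ => erefl) mD).
  rewrite (joint_law VX' (fun _ _ => erefl) XX' mD).
  by rewrite !probability_region_mul// VXVX'.
apply: eq_measure_itv_pos; [exact: positive_rv_gt0|exact: positive_rv_gt0|].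
(* The two inequalities come from the same comparison with the roles of the two laws exchanged. *)
move=> s s0; apply/eqP; rewrite eq_le; apply/andP; split;
    apply: le_measure_itv_right => t st.
- exact: (le_measure_itv r0 c0 cE munu).
- by apply: (le_measure_itv r0 c0 cE) => // b b0; rewrite munu.
Qed.

Lemma positive_rv_mul (R : realType) (d : measure_display)
    (T : measurableType d) (P : probability T R) (V W : {RV P >-> R}) :
  positive_rv V -> positive_rv W -> positive_rv (V * W : {RV P >-> R}).
Proof.
by move=> V0 W0; apply: filterS2 V0 W0 => w; exact: mulr_gt0.
Qed.

(** [factor_law] speaks of a pair on some other space; independence makes the law of the product
    depend on the marginal laws alone, so it transfers to the given pair. *)
Lemma factor_law_mul (R : realType) (u v : R)
    (d : measure_display) (T : measurableType d) (P : probability T R)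
    (V X : {RV P >-> R}) :
  factor_law u v V -> gnormal_law v X -> independent_rv V X ->
  gnormal_law u (V * X : {RV P >-> R}).
Proof.
move=> [d' [T' [P' [V' [X' [_ X'v I' V'X'u VV']]]]]] Xv VX A mA.
have VX' := mutually_independent2 I'.
rewrite -V'X'u//; apply: (eq_dist_mul VX VX') => // B mB.
by rewrite Xv// X'v.
Qed.

Theorem corollary1 (R : realType) (p q r : R)
  (p_gt0 : 0 < p) (le_pq : p <= q) (le_qr : q <= r)
  (d : measure_display) (T : measurableType d) (P : probability T R)
  (Vpq Vqr Xr : {RV P >-> R})
  (Vpq_gt0 : positive_rv Vpq) (Vpq_law : factor_law p q Vpq)
  (Vqr_gt0 : positive_rv Vqr) (Vqr_law : factor_law q r Vqr)
  (Xr_law : gnormal_law r Xr)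
  (indep : mutually_independent [tuple Vpq; Vqr; Xr])
  (d' : measure_display) (T' : measurableType d') (P' : probability T' R)
  (Vpr : {RV P' >-> R})
  (Vpr_gt0 : positive_rv Vpr) (Vpr_law : factor_law p r Vpr) :
  eq_dist Vpr (Vpq * Vqr : {RV P >-> R}).
Proof.
have r_gt0 : 0 < r by rewrite (lt_le_trans p_gt0)// (le_trans le_pq).
have I3 := mutually_independent3 indep.
have Iqr_r : independent_rv Vqr Xr.
  move=> A B mA mB; have := I3 _ _ _ measurableT mA mB.
  by rewrite preimage_setT setTI probability_setT mul1e.
have Ipq_qrr : independent_rv Vpq (Vqr * Xr : {RV P >-> R}).
  exact: independent_mulr.
have Ipr_r : independent_rv (Vpq * Vqr : {RV P >-> R}) Xr.
  (* [independent_mulr] groups the last two of three variables, so the triple is rotated to put [Xr]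
     first. *)
  have Ir : independent_rv Xr (Vpq * Vqr : {RV P >-> R}).
    apply: independent_mulr => A B C mA mB mC.
    by rewrite setIC -setIA I3// muleA muleC.
  by move=> A B mA mB; rewrite setIC Ir// muleC.
have law_p : gnormal_law p (Vpq * Vqr * Xr : {RV P >-> R}).
  have := factor_law_mul Vpq_law (factor_law_mul Vqr_law Xr_law Iqr_r) Ipq_qrr.
  by rewrite mulrA.
(* The space of [Vpr] may carry no suitable N_r variable, so uniqueness is applied to the copy [V1]
   of [Vpr] with its partner [X1]. *)
have [d1 [T1 [P1 [V1 [X1 [V1_gt0 X1_law I1 law1 V1E]]]]]] := Vpr_law.
have {}I1 := mutually_independent2 I1.
have V1_law : eq_dist V1 (Vpq * Vqr : {RV P >-> R}).
  apply: (gnormal_factor_unique r_gt0 V1_gt0 _ I1 Ipr_r X1_law Xr_law).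
    exact: positive_rv_mul.
  by move=> A mA; rewrite law1// law_p.
by move=> A mA; rewrite V1E// V1_law.
Qed.
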